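(* Let $\pi=[a_1,a_2,\dots,a_l]\in S_m$ be any $l$-layer $(l>1)$ generalized pattern without hyphens. If there exists a positive integer $j\le l-2$ such that $a_1\le a_{j+1}$, $a_i=a_{i+j}$ for all $2\le i\le l-j-1$, and $a_{l-j}\ge a_l$, let $j_0$ be the least such $j$ and set $M_\pi=a_2+\dots+a_{j_0+1}$; otherwise set $M_\pi=\max\{a_1,a_l\}+a_2+\dots+a_{l-1}$. Then $\delta(\pi)=\delta'(\pi)=1/M_\pi$.
   Context: $[a_1,\dots,a_l]$ (all $a_i\ge1$, $a_1+\dots+a_l=m$) denotes the layered permutation that is a concatenation of strictly decreasing substrings (layers) of lengths $a_1,\dots,a_l$ from left to right such that every letter of an earlier layer is smaller than every letter of a later layer (e.g. $[3,2,4]=321549876$). $[k]=\{1,\dots,k\}$ and $[k]^n$ is the set of words of length $n$ over $[k]$. Two words $u,v$ of the same length are order-isomorphic if for all positions $i,j$: $u_i<u_j\iff v_i<v_j$. An occurrence of a generalized pattern $\pi$ of length $m$ without hyphens in a word $\sigma=\sigma_1\cdots\sigma_n$ is a factor of $m$ consecutive letters $\sigma_i\sigma_{i+1}\cdots\sigma_{i+m-1}$ order-isomorphic to $\pi$; $\nu(\pi,\sigma)$ is the number of occurrences. Such a pattern has one block, and for $n\ge m$ one sets $\delta(\pi,k,n)=\max\{\nu(\pi,\sigma):\sigma\in[k]^n\}/(n-m+1)$. Then $\delta(\pi)=\lim_{n\to\infty}\lim_{k\to\infty}\delta(\pi,k,n)=\lim_{n\to\infty}\delta(\pi,n,n)$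 (for $k\ge n$, $\delta(\pi,k,n)=\delta(\pi,n,n)$) and $\delta'(\pi)=\lim_{k\to\infty}\lim_{n\to\infty}\delta(\pi,k,n)$. *)

(* Defs.v *)
From HB Require Import structures.
From mathcomp Require Import all_boot all_order all_algebra.
From mathcomp Require Import all_classical all_reals all_analysis.
Import Order.TTheory GRing.Theory Num.Theory.
Import numFieldNormedType.Exports.

Set Implicit Arguments.
Unset Strict Implicit.
Unset Printing Implicit Defensive.

Local Open Scope ring_scope.

(* Permutations and words are sequences of letters 1, 2, ... in one-line
   notation. *)

Fixpoint layered_from (s : nat) (a : seq nat) : seq nat :=
  if a is x :: a' then rev (iota s.+1 x) ++ layered_from (s + x)%N a'
  else [::].

(* The layered permutation [a_1, ..., a_l] of {1, ..., sumn a}. *)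
Definition layered (a : seq nat) : seq nat := layered_from 0 a.

Example layered_324 :
  layered [:: 3; 2; 4]%N = [:: 3; 2; 1; 5; 4; 9; 8; 7; 6]%N.
Proof. by []. Qed.

Lemma size_layered (a : seq nat) : size (layered a) = sumn a.
Proof.
rewrite /layered; elim: a 0%N => [//|x a IHa] s /=.
by rewrite size_cat size_rev size_iota IHa.
Qed.

Definition order_iso (u v : seq nat) : bool :=
  (size u == size v) &&
  all2rel (fun i j => (nth 0 u i < nth 0 u j) == (nth 0 v i < nth 0 v j))%N
    (iota 0 (size u)).

(* [order_iso] forces the factor to have length [size p], so starting
   positions too close to the end of [w] are not counted. *)
Definition nu (p w : seq nat) : nat :=
  count (fun i => order_iso p (take (size p) (drop i w))) (iota 0 (size w)).

(* A word of [k]^n is an n-tuple over 'I_k; the element c of 'I_k stands for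
   the letter c + 1. *)
Definition letters (k n : nat) (w : n.-tuple 'I_k) : seq nat :=
  [seq (val c).+1 | c : 'I_k <- w].

Definition max_nu (p : seq nat) (k n : nat) : nat :=
  \max_(w : n.-tuple 'I_k) nu p (letters w).

(* Meaningful for size p <= n only, because of the truncated subtraction. *)
Definition density (R : realType) (p : seq nat) (k n : nat) : R :=
  (max_nu p k n)%:R / (n - size p + 1)%:R.

Definition delta (R : realType) (p : seq nat) : R :=
  limn (fun n => limn (fun k => density R p k n)).

Definition delta' (R : realType) (p : seq nat) : R :=
  limn (fun k => limn (fun n => density R p k n)).

(* a_i, with indices starting at 1. *)
Definition layer (a : seq nat) (i : nat) : nat := nth 0%N a i.-1.

Definition self_overlap (a : seq nat) (j : nat) : bool :=
  let l := size a in
  [&& (layer a 1 <= layer a j.+1)%N,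
      all (fun i => layer a i == layer a (i + j)) (index_iota 2 (l - j))
    & (layer a l <= layer a (l - j))%N].

(* The candidates j range over 1 <= j <= l - 2 in increasing order, so the
   head of the filtered list is the least admissible j. *)
Definition M_pi (a : seq nat) : nat :=
  let l := size a in
  if [seq j <- iota 1 (l - 2) | self_overlap a j] is j0 :: _
  then (\sum_(2 <= i < j0.+2) layer a i)%N
  else (maxn (layer a 1) (layer a l) + \sum_(2 <= i < l) layer a i)%N.

(* Main.v *)
Require Import Defs.
From HB Require Import structures.
From mathcomp Require Import all_boot all_order all_algebra.
From mathcomp Require Import all_classical all_reals all_analysis.
From mathcomp Require Import zify lra ring.
Import Order.TTheory GRing.Theory Num.Theory.
Import numFieldNormedType.Exports.

Set Implicit Arguments.
Unset Strict Implicit.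
Unset Printing Implicit Defensive.

(** The order type of a layered permutation is determined by its cuts, the
    positions where a new layer starts: for [i < j], the letter at [j] exceeds
    the letter at [i] if and only if some cut [x] has [i < x <= j]. Two
    occurrences in a word at distance [d] therefore force the cuts of the
    pattern to agree with their translate by [d] on the common part
    ([overlap_of_occurrences]).

    The number [M_pi a] is the least positive [d] with this property
    ([M_piP]). Indeed, if the common part contains a cut of the unshifted copy,
    matching cuts one after the other yields the index shift [j] of the
    statement; otherwise the common part lies within the last layer of one copy
    and the first layer of the other.

    Upper bound: occurrences are at least [M_pi a] apart, so a word of length
    [n] has at most [n / M_pi a + 1] of them ([max_nu_upper]).

    Lower bound: as the cuts agree with their translate by [M_pi a], they can be
    repeated with period [M_pi a] without creating new cuts inside a copy. A
    word with these cuts has an occurrence at every multiple of [M_pi a] that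
    leaves enough room, hence about [n / M_pi a] in total, and it uses at most
    [n ^ 2 + n] letters ([max_nu_lower]).

    For [delta], where the alphabet goes to infinity first, both bounds apply
    for every fixed length and squeeze the outer limit. For [delta'],
    concatenation makes the maximal count superadditive in the length, so by
    Fekete's lemma ([fekete]) the inner limit exists and is at least the maximal
    count at any single length [n], divided by [n]. That is at least
    [1 / M_pi a] up to [O(1 / n)] as soon as the alphabet has [n ^ 2 + n]
    letters. *)

(** * Cuts of a layered permutation *)

Definition psum (a : seq nat) (r : nat) : nat := sumn (take r a).

(** The ends [0] and [sumn a] are included, so that [cutP] holds without a
    range condition on [r]. *)
Definition cut (a : seq nat) (x : nat) : bool :=
  x \in [seq psum a r | r <- iota 0 (size a).+1].

(** The autocorrelation condition: on the common part of two copies of the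
    permutation placed [d] apart, the layers start at the same places. *)
Definition overlap (a : seq nat) (d : nat) : Prop :=
  forall x, 0 < x -> x + d < sumn a -> cut a (x + d) = cut a x.

Lemma psum_oversize a r : size a <= r -> psum a r = sumn a.
Proof. by move=> h; rewrite /psum take_oversize. Qed.

Lemma cutP a x : reflect (exists r, x = psum a r) (cut a x).
Proof.
apply: (iffP mapP) => [[r _ ->]|[r ->]]; first by exists r.
have [h|h] := leqP r (size a); first by exists r => //; rewrite mem_iota.
exists (size a); first by rewrite mem_iota /= add0n.
by rewrite !psum_oversize // ltnW.
Qed.

Lemma psumS a r : psum a r.+1 = psum a r + nth 0 a r.
Proof.
rewrite /psum; elim: a r => [|x a IH] [|r] //=; first by rewrite take0 addn0.
by rewrite IH addnA.
Qed.

Lemma leq_psum a r t : r <= t -> psum a r <= psum a t.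
Proof.
move=> /subnKC <-; elim: (t - r) => [|k IH]; first by rewrite addn0.
by rewrite addnS psumS; lia.
Qed.

Lemma ltn_psum a r t : all (fun x => 0 < x) a ->
  t < size a -> r <= t -> psum a r < psum a t.+1.
Proof.
move=> /all_nthP a_gt0 ht hr; rewrite psumS.
by have := leq_psum a hr; have := a_gt0 0 _ ht; lia.
Qed.

Lemma psum_inj_lt a r t : psum a r < psum a t -> r < t.
Proof. by rewrite !ltnNge; apply: contra; apply: leq_psum. Qed.

Lemma layered_from_gt s a c : c \in layered_from s a -> s < c.
Proof.
elim: a s => [//|x a IH] s /=; rewrite mem_cat mem_rev mem_iota.
by case/orP => [|/IH]; lia.
Qed.

Lemma nth_layered_head s x i : i < x ->
  nth 0 (rev (iota s.+1 x)) i = s + x - i.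
Proof. by move=> h; rewrite nth_rev size_iota // nth_iota; lia. Qed.

Lemma size_layered_from s a : size (layered_from s a) = sumn a.
Proof.
by elim: a s => [//|x a IH] s /=; rewrite size_cat size_rev size_iota IH.
Qed.

(** Layers increase and each layer decreases, so a later letter is larger
    exactly when a new layer has started in between. This makes the cuts
    determine the whole order type. *)
Lemma layered_from_cmp s a i j : i < j < sumn a ->
  let p := layered_from s a in
  ((exists r, i < psum a r <= j) /\ nth 0 p i < nth 0 p j) \/
  (~ (exists r, i < psum a r <= j) /\ nth 0 p j < nth 0 p i).
Proof.
elim: a s i j => [|x a IH] s i j /=; first by lia.
case/andP=> hij hj; rewrite !nth_cat size_rev size_iota.
have [hjx|hjx] := ltnP j x.
  rewrite (ltn_trans hij hjx) !nth_layered_head //; last lia.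
  right; split; last lia.
  by case=> [[|r]]; rewrite /psum /= ?take0 /=; lia.
have [hix|hix] := ltnP i x.
  left; split; first by exists 1; rewrite /psum /= take0 /= addn0 hix.
  rewrite nth_layered_head //.
  have : nth 0 (layered_from (s + x) a) (j - x) \in layered_from (s + x) a.
    by rewrite mem_nth // size_layered_from; lia.
  by move/layered_from_gt; lia.
have -> : (exists r, i < psum (x :: a) r <= j) <->
          (exists r, i - x < psum a r <= j - x).
  split=> [[[|r]]|[r]]; rewrite /psum /=; first lia.
    by move=> h; exists r; lia.
  by move=> h; exists r.+1 => /=; lia.
by apply: IH; lia.
Qed.

Lemma layered_ltP a i j : i < j < sumn a ->
  reflect (exists2 x, i < x <= j & cut a x)
          (nth 0 (layered a) i < nth 0 (layered a) j).
Proof.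
move=> hij; apply: (iffP idP) => [|[x hx /cutP [r er]]];
  have [[h1 h2]|[h1 h2]] := layered_from_cmp 0 hij.
- by move=> _; have [r hr] := h1; exists (psum a r) => //; apply/cutP; exists r.
- by rewrite /layered; lia.
- by [].
- by case: h1; exists r; rewrite -er.
Qed.

Lemma layered_gtE a i j : i < j < sumn a ->
  (nth 0 (layered a) j < nth 0 (layered a) i) =
  ~~ (nth 0 (layered a) i < nth 0 (layered a) j).
Proof.
move=> hij; rewrite /layered.
by case: (layered_from_cmp 0 hij); lia. Qed.

Lemma order_isoP u v :
  reflect (size u = size v /\ forall i j, i < size u -> j < size u ->
             (nth 0 u i < nth 0 u j) = (nth 0 v i < nth 0 v j))
          (order_iso u v).
Proof.
apply: (iffP andP) => [[/eqP es /allrelP h]|[es h]]; split=> //.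
- move=> i j hi hj.
  by have := h i j; rewrite !mem_iota /= !add0n => /(_ hi hj)/eqP.
- exact/eqP.
- by apply/allrelP => i j; rewrite !mem_iota /= !add0n => hi hj; rewrite h.
Qed.

(** * Overlapping occurrences *)

Definition occurs_at (p w : seq nat) (i : nat) : bool :=
  order_iso p (take (size p) (drop i w)).

Lemma occurs_atP p w i : 0 < size p ->
  reflect (i + size p <= size w /\ forall x y, x < size p -> y < size p ->
             (nth 0 p x < nth 0 p y) = (nth 0 w (i + x) < nth 0 w (i + y)))
          (occurs_at p w i).
Proof.
move=> p0; apply: (iffP (order_isoP _ _)) => [[]|[hi h]].
  rewrite size_take size_drop => es h; split; first by case: ltnP es; lia.
  by move=> x y hx hy; rewrite h // !nth_take // !nth_drop.
split; first by rewrite size_takel // size_drop; lia.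
by move=> x y hx hy; rewrite !nth_take // !nth_drop h.
Qed.

(** An inner cut is an ascent between neighbours, and ascents are read off the
    word; on the common part both occurrences read the same ascents. *)
Lemma overlap_of_occurrences a w i d :
  occurs_at (layered a) w i -> occurs_at (layered a) w (i + d) -> overlap a d.
Proof.
move=> /occurs_atP H1 /occurs_atP H2 x x0 hx.
have m0 : 0 < size (layered a) by rewrite size_layered; lia.
have [_ h1] := H1 m0; have [_ h2] := H2 m0.
have cutE y : 0 < y < sumn a ->
    cut a y = (nth 0 (layered a) y.-1 < nth 0 (layered a) y).
  move=> hy; apply/idP/layered_ltP; first lia.
    by move=> cy; exists y => //; lia.
  by case=> z hz; have -> : z = y by lia.
rewrite !cutE; try lia.
rewrite h1 ?size_layered; try lia.
rewrite h2 ?size_layered; try lia.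
by congr (nth 0 w _ < nth 0 w _); lia.
Qed.

(** * The least overlap shift *)

Section Period.
Variable a : seq nat.
Hypotheses (a_gt0 : all (fun x => 0 < x) a) (l_gt1 : 1 < size a).

Lemma sum_layer j : \sum_(2 <= i < j.+2) layer a i = psum a j.+1 - psum a 1.
Proof.
elim: j => [|j IH]; first by rewrite big_geq // subnn.
rewrite big_nat_recr //= IH [psum a j.+2]psumS /layer /=.
by have := leq_psum a (isT : 1 <= j.+1); lia.
Qed.

Lemma layer1E : layer a 1 = psum a 1.
Proof. by rewrite psumS /psum take0. Qed.

Lemma layerS i : psum a i + layer a i.+1 = psum a i.+1.
Proof. by rewrite psumS. Qed.

Lemma psum_size : psum a (size a) = sumn a.
Proof. exact: psum_oversize. Qed.

(** Shifting by this amount makes the two copies share only the shorter of the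
    first and the last layer, where the pattern is decreasing. *)
Definition trivial_shift := maxn (layer a 1) (layer a (size a)) +
  (psum a (size a).-1 - psum a 1).

Lemma overlap_trivial_shift : overlap a trivial_shift.
Proof.
move=> x x0 hx.
have h0 : psum a 0 = 0 by rewrite /psum take0.
have hm := leq_psum a (_ : 1 <= (size a).-1); have {}hm := hm ltac:(lia).
have hl := layerS (size a).-1.
have e : (size a).-1.+1 = size a by lia.
rewrite e psum_size in hl; have h1 := layer1E.
rewrite /trivial_shift in hx *.
have -> : cut a x = false.
  apply/negP => /cutP [[|r]]; first lia.
  by have := leq_psum a (isT : 1 <= r.+1); lia.
apply/negP => /cutP [r er].
have [hr|hr] := leqP r (size a).-1; first by have := leq_psum a hr; lia.
by rewrite (@psum_oversize a r) in er; lia.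
Qed.

(** An admissible [j] makes the inner layers [j]-periodic, so raising the index
    of a cut by [j] always moves the cut by the same distance. *)
Lemma psum_shift j : 0 < j <= size a - 2 -> self_overlap a j ->
  forall i, 0 < i -> i + j < size a ->
  psum a i + (psum a j.+1 - psum a 1) = psum a (i + j).
Proof.
move=> hj /and3P [_ /allP hall _]; elim=> [//|[|i] IH] _ hi.
  by have := leq_psum a (isT : 1 <= j.+1); rewrite add1n; lia.
have {}IH := IH isT ltac:(lia).
have /eqP : layer a i.+2 == layer a (i.+2 + j)
  by apply: hall; rewrite mem_index_iota; lia.
by move: IH (layerS i.+1) (layerS (i.+1 + j)) => /[swap] /[swap];
  rewrite !addSn; lia.
Qed.

(** The inner cuts are matched by [psum_shift]. The inequalities between the
    boundary layers of [self_overlap] put every other cut outside the common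
    part. *)
Lemma overlap_self_overlap j : 0 < j <= size a - 2 -> self_overlap a j ->
  overlap a (psum a j.+1 - psum a 1).
Proof.
move=> hj so x x0 hx; have ps := psum_shift hj so.
case/and3P: so => so1 _ so2.
have h0 : psum a 0 = 0 by rewrite /psum take0.
have h1 := leq_psum a (isT : 1 <= j.+1).
have hl := layerS (size a).-1.
have e : (size a).-1.+1 = size a by lia.
rewrite e psum_size in hl.
apply/cutP/cutP => [[i ei]|[i ei]]; last first.
  have [hi|hi] := ltnP (i + j) (size a).
    by exists (i + j); rewrite ei ps //; case: i ei {hi} => [|//]; lia.
  have := ps (size a - j.+1) ltac:(lia) ltac:(lia).
  have -> : size a - j.+1 + j = (size a).-1 by lia.
  have := layerS (size a - j.+1).
  have -> : (size a - j.+1).+1 = size a - j by lia.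
  have := leq_psum a (_ : size a - j <= i); move=> /(_ ltac:(lia)).
  by lia.
have [hi|hi] := leqP i j.
  by have := leq_psum a hi; have := layerS j; have := layer1E; lia.
have [hil|hil] := ltnP i (size a).
  by exists (i - j); have := ps (i - j) ltac:(lia) ltac:(lia); rewrite subnK; lia.
by rewrite (@psum_oversize a i) in ei; lia.
Qed.

(** If the first cut stays inside under the shift, it lands on some cut number
    [j + 1]; since the shift matches cuts in both directions, consecutive cuts
    land on consecutive cuts, and this [j] is admissible. If the first cut does
    not stay inside, the common part lies within a single layer of each copy. *)
Lemma overlap_inv d : 0 < d -> overlap a d ->
  (exists j, [/\ 0 < j <= size a - 2, self_overlap a j &
                 d = psum a j.+1 - psum a 1]) \/ trivial_shift <= d.
Proof.
move=> d0 ov.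
have h0 : psum a 0 = 0 by rewrite /psum take0.
have hl := layerS (size a).-1.
have e : (size a).-1.+1 = size a by lia.
rewrite e psum_size in hl; have h1 := layer1E.
have lt r t : r < t -> t <= size a -> psum a r < psum a t.
  by case: t => // t hr ht; apply: ltn_psum.
have hm := leq_psum a (_ : 1 <= (size a).-1); have {}hm := hm ltac:(lia).
have s1 := lt 0 1 isT ltac:(lia).
have sl := lt (size a).-1 (size a) ltac:(lia) (leqnn _).
rewrite psum_size in sl.
have [hd|hd] := ltnP (psum a 1 + d) (sumn a); last first.
  right; rewrite /trivial_shift.
  have [hd'|hd'] := ltnP d (psum a (size a).-1); last lia.
  have /cutP [[|r] er] : cut a (psum a (size a).-1 - d).
  - rewrite -ov; try lia; rewrite subnK; last lia.
    by apply/cutP; exists (size a).-1.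
  - by lia.
  - by have := leq_psum a (isT : 1 <= r.+1); lia.
left.
have /cutP [[|j] ej] : cut a (psum a 1 + d).
- by rewrite ov; try lia; apply/cutP; exists 1.
- lia.
have j0 : 0 < j by case: (j) ej => [|//]; lia.
have jl : j.+1 < size a.
  by rewrite ltnNge; apply/negP => /psum_oversize; lia.
have ps i : 0 < i -> i + j < size a -> psum a i + d = psum a (i + j).
  (* Pulling the cut [i.+2 + j] back and pushing the cut [i.+2] forward give
     the two inequalities of the inductive step. *)
  elim: i => [//|[|i] IH] _ hi; first by rewrite add1n.
  have {}IH := IH isT ltac:(lia).
  have h2 := lt (i.+1 + j) (i.+2 + j) ltac:(lia) ltac:(lia).
  have h3 := lt (i.+2 + j) (size a) ltac:(lia) ltac:(lia).
  rewrite psum_size in h3.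
  have /cutP [r er] : cut a (psum a (i.+2 + j) - d).
    rewrite -ov; try lia; rewrite subnK; last lia.
    by apply/cutP; exists (i.+2 + j).
  have hr : i.+1 < r by apply: (@psum_inj_lt a); lia.
  have h4 := leq_psum a hr.
  have h5 := lt i.+1 i.+2 ltac:(lia) ltac:(lia).
  have /cutP [t et] : cut a (psum a i.+2 + d).
    by rewrite ov; try lia; apply/cutP; exists i.+2.
  have ht : i.+1 + j < t by apply: (@psum_inj_lt a); lia.
  have := leq_psum a (_ : i.+2 + j <= t); move=> /(_ ltac:(lia)).
  lia.
have hpl := ps (size a - j.+1) ltac:(lia) ltac:(lia).
have e2 : size a - j.+1 + j = (size a).-1 by lia.
have e3 : (size a - j.+1).+1 = size a - j by lia.
rewrite e2 in hpl.
exists j; split; first lia; last lia.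
apply/and3P; split.
- have [hjd|hjd] := leqP (psum a j) d; first by have := layerS j; lia.
  have h2 := lt j j.+1 ltac:(lia) ltac:(lia).
  have /cutP [[|r] er] : cut a (psum a j - d).
  + rewrite -ov; try lia; rewrite subnK; last lia.
    by apply/cutP; exists j.
  + lia.
  + by have := leq_psum a (isT : 1 <= r.+1); lia.
- apply/allP => -[|[|i]]; rewrite mem_index_iota // => hi; try lia.
  have := ps i.+1 ltac:(lia) ltac:(lia); have := ps i.+2 ltac:(lia) ltac:(lia).
  by have := layerS i.+1; have := layerS (i.+1 + j); rewrite !addSn; lia.
- have hs := layerS (size a - j.+1); rewrite e3 in hs.
  have [hd'|hd'] := leqP (sumn a) (psum a (size a - j) + d); first lia.
  have h3 := lt (size a - j.+1) (size a - j) ltac:(lia) ltac:(lia).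
  have /cutP [r er] : cut a (psum a (size a - j) + d).
    by rewrite ov; try lia; apply/cutP; exists (size a - j).
  have hr : (size a).-1 < r by apply: (@psum_inj_lt a); lia.
  by rewrite (@psum_oversize a r) in er; lia.
Qed.

(** The shift attached to an admissible [j] grows with [j] and never exceeds
    [trivial_shift], so the least admissible [j] gives the least overlap
    shift. *)
Lemma M_piP : [/\ 0 < M_pi a, overlap a (M_pi a) &
  forall d, 0 < d -> overlap a d -> M_pi a <= d].
Proof.
have e : size a = (size a - 2).+2 by lia.
have ets : trivial_shift =
    maxn (layer a 1) (layer a (size a)) + \sum_(2 <= i < size a) layer a i.
  rewrite {2}e sum_layer /trivial_shift; congr (_ + (psum a _ - _)); lia.
have s1 := @ltn_psum a 0 0 a_gt0 ltac:(lia) isT.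
rewrite /M_pi -ets.
case ef: [seq _ <- _ | _] => [|j0 s].
  split.
  - by rewrite /trivial_shift layer1E; lia.
  - exact: overlap_trivial_shift.
  move=> d d0 /(overlap_inv d0) [[j [hj so _]]|//].
  have : j \in [seq j <- iota 1 (size a - 2) | self_overlap a j].
    by rewrite mem_filter so mem_iota; lia.
  by rewrite ef.
have : j0 \in [seq j <- iota 1 (size a - 2) | self_overlap a j].
  by rewrite ef inE eqxx.
rewrite mem_filter mem_iota => /andP [so hj].
rewrite sum_layer.
have h2 := @ltn_psum a 1 j0 a_gt0 ltac:(lia) ltac:(lia).
split; first lia.
  by apply: overlap_self_overlap => //; lia.
move=> d d0 /(overlap_inv d0) [[j [hj' soj ->]]|ht].
  have : j \in j0 :: s by rewrite -ef mem_filter soj mem_iota; lia.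
  have : sorted ltn (j0 :: s).
    by rewrite -ef; apply: sorted_filter (iota_ltn_sorted _ _) => ? ? ?; lia.
  rewrite /= (path_sortedE ltn_trans) inE => /andP [/allP hs _].
  move=> /orP [/eqP -> //|/hs hlt].
  by apply/leq_sub2r/leq_psum; lia.
have := leq_psum a (_ : j0.+1 <= (size a).-1); move=> /(_ ltac:(lia)).
by rewrite /trivial_shift in ht; lia.
Qed.

End Period.

(** * The upper bound on the number of occurrences *)

(** Division by [M] separates points that are at least [M] apart. *)
Lemma count_spaced (P : pred nat) n M : 0 < M ->
  (forall i j, i < j -> P i -> P j -> i + M <= j) ->
  count P (iota 0 n) * M <= n + M.
Proof.
move=> M0 sp; rewrite -size_filter.
set s := seq.filter _ _; rewrite -(size_map (fun i => i %/ M) s).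
have us : uniq [seq i %/ M | i <- s].
  rewrite map_inj_in_uniq ?filter_uniq ?iota_uniq //.
  move=> i j; rewrite !mem_filter => /andP [Pi _] /andP [Pj _] eij.
  case: (ltngtP i j) => // h; [have := sp _ _ h Pi Pj|have := sp _ _ h Pj Pi];
    by move/(leq_div2r M); rewrite divnDr ?divnn ?M0 //; lia.
have := uniq_leq_size us (s2 := iota 0 (n %/ M).+1).
rewrite size_iota => h.
have {}h : size [seq i %/ M | i <- s] <= (n %/ M).+1.
  apply: h => x /mapP [i]; rewrite mem_filter !mem_iota => /andP [_ hi] ->.
  by rewrite /= !add0n ltnS leq_div2r //; lia.
have := leq_trunc_div n M; have := leq_mul h (leqnn M); rewrite mulSn; lia.
Qed.

Lemma nu_upper a w : all (fun x => 0 < x) a -> 1 < size a ->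
  nu (layered a) w * M_pi a <= size w + M_pi a.
Proof.
move=> a0 l1; have [M0 _ minM] := M_piP a0 l1.
apply: count_spaced => // i j hij oi oj.
have := @overlap_of_occurrences a w i (j - i) oi.
by rewrite subnKC ?(ltnW hij) // => /(_ oj) /minM; lia.
Qed.

(** * A word with many occurrences *)

(** A word of length [n] whose relative order is that of a layered permutation
    with cuts at [P]: passing a cut adds [n], which outweighs the at most
    [n - 1] unit descents. The alphabet is larger than a permutation would
    need, which is harmless since the alphabet grows without bound. *)
Definition cut_word (P : pred nat) (n : nat) : seq nat :=
  mkseq (fun t => count P (iota 1 t) * n + (n - t)) n.

Lemma count_iota_split (P : pred nat) x y : x <= y -> count P (iota 1 y) =
  count P (iota 1 x) + count P (iota x.+1 (y - x)).
Proof. by move=> h; rewrite -{1}(subnKC h) iotaD count_cat. Qed.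

Lemma cut_word_ltP (P : pred nat) n i j : i < j < n ->
  reflect (exists2 x, i < x <= j & P x)
          (nth 0 (cut_word P n) i < nth 0 (cut_word P n) j).
Proof.
move=> hij; rewrite !nth_mkseq; try lia.
rewrite (@count_iota_split P i j); last lia.
apply: (iffP idP) => [h|[x hx cx]].
  have : 0 < count P (iota i.+1 (j - i)).
    by case: (count _ (iota i.+1 _)) h => //; rewrite addn0; lia.
  by rewrite -has_count => /hasP [x]; rewrite mem_iota => hx cx; exists x => //; lia.
have : 0 < count P (iota i.+1 (j - i)).
  by rewrite -has_count; apply/hasP; exists x; rewrite // mem_iota; lia.
case: (count _ (iota i.+1 _)) => // c _; rewrite mulnDl mulSn; lia.
Qed.

Lemma cut_word_gtE (P : pred nat) n i j : i < j < n ->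
  (nth 0 (cut_word P n) j < nth 0 (cut_word P n) i) =
  ~~ (nth 0 (cut_word P n) i < nth 0 (cut_word P n) j).
Proof.
move=> hij; rewrite !nth_mkseq; try lia.
rewrite (@count_iota_split P i j); last lia.
by case: (count _ (iota i.+1 _)) => [|c]; rewrite ?addn0 ?mulnDl ?mulSn; lia.
Qed.

Lemma cut_word_letters (P : pred nat) n :
  all (fun c => 0 < c <= n * n + n) (cut_word P n).
Proof.
apply/allP => c /mapP [t]; rewrite mem_iota => ht ->.
have : count P (iota 1 t) <= n.
  by apply: leq_trans (count_size _ _) _; rewrite size_iota; lia.
move=> /(fun h => leq_mul h (leqnn n)); lia.
Qed.

Section Construction.
Variables (a : seq nat) (M : nat).
Hypotheses (M0 : 0 < M) (ovM : overlap a M).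

Definition periodic_cut (x : nat) : bool :=
  has (fun y => cut a y && (y == x %[mod M])) (iota 1 (sumn a).-1).

Lemma overlap_mul q x : 0 < x -> x + q * M < sumn a ->
  cut a (x + q * M) = cut a x.
Proof.
elim: q => [|q IH] x0 hx; first by rewrite addn0.
have e : x + q.+1 * M = x + q * M + M by lia.
by rewrite e ovM ?IH //; lia.
Qed.

(** Repeating the cuts adds no new cut inside the pattern: a cut translated by
    a multiple of [M] that stays inside is already a cut, by [ovM]. *)
Lemma periodic_cutE x : 0 < x < sumn a -> periodic_cut x = cut a x.
Proof.
move=> hx; apply/hasP/idP => [[y]|cx]; last first.
  by exists x; rewrite ?cx ?eqxx ?mem_iota //; lia.
rewrite mem_iota => hy /andP [cy eyx].
have [hxy|hxy] := leqP x y.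
  move: eyx; rewrite eqn_mod_dvd // => /dvdnP [q eq].
  have ey : y = x + q * M by lia.
  by rewrite -(@overlap_mul q) -?ey //; lia.
move: eyx; rewrite eq_sym eqn_mod_dvd; last lia.
move=> /dvdnP [q eq].
have ex : x = y + q * M by lia.
by rewrite ex overlap_mul -?ex //; lia.
Qed.

Lemma periodic_cutD q x : periodic_cut (q * M + x) = periodic_cut x.
Proof. by apply: eq_has => y; rewrite modnMDl. Qed.

Lemma occurs_at_cut_word n q : 0 < sumn a -> q * M + sumn a <= n ->
  occurs_at (layered a) (cut_word periodic_cut n) (q * M).
Proof.
move=> m0 hn; apply/occurs_atP; rewrite size_layered //.
split=> [|x y hx hy]; first by rewrite size_mkseq.
have main i j : i < j < sumn a ->
    (nth 0 (layered a) i < nth 0 (layered a) j) =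
    (nth 0 (cut_word periodic_cut n) (q * M + i) < 
     nth 0 (cut_word periodic_cut n) (q * M + j)).
  move=> hij; apply/layered_ltP/cut_word_ltP => //; first lia.
    case=> z hz cz; exists (q * M + z); first lia.
    by rewrite periodic_cutD periodic_cutE //; lia.
  case=> z hz; have -> : z = q * M + (z - q * M) by lia.
  by rewrite periodic_cutD periodic_cutE => [cz|]; [exists (z - q * M) => //|]; lia.
case: (ltngtP x y) => [h|h|->]; last by rewrite !ltnn.
  by apply: main; rewrite h.
have hyx : y < x < sumn a by rewrite h.
rewrite layered_gtE // main // [RHS]cut_word_gtE //.
by rewrite ltn_add2l h /=; apply: leq_trans hn; rewrite ltn_add2l.
Qed.

Lemma cut_word_lower n : 0 < sumn a -> 
  n <= nu (layered a) (cut_word periodic_cut n) * M + (sumn a + M).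
Proof.
move=> m0; have [hn|hn] := ltnP n (sumn a); first lia.
have : (n - sumn a) %/ M <= nu (layered a) (cut_word periodic_cut n).
  rewrite /nu -size_filter -[X in X <= _](size_iota 0) -(size_map (fun q => q * M)).
  apply: uniq_leq_size.
    by rewrite map_inj_uniq ?iota_uniq // => i j /eqP; rewrite eqn_pmul2r // => /eqP.
  move=> x /mapP [q]; rewrite mem_iota => hq ->.
  have hq' : q * M + sumn a <= n.
    by have := leq_trunc_div (n - sumn a) M;
      have := @leq_mul2r M q ((n - sumn a) %/ M); lia.
  rewrite mem_filter; apply/andP; split; first exact: occurs_at_cut_word.
  by rewrite mem_iota size_mkseq /=; lia.
have := ltn_ceil (n - sumn a) M0; rewrite mulSn.
move=> h1 /(fun h => leq_mul h (leqnn M)); lia.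
Qed.

End Construction.

(** * Maximal numbers of occurrences *)

Lemma nu_cat p u v : nu p u + nu p v <= nu p (u ++ v).
Proof.
rewrite /nu size_cat iotaD count_cat add0n
  -[in X in _ <= _ + X](addn0 (size u)) iotaDl count_map.
apply: leq_add.
  rewrite -!size_filter; apply: uniq_leq_size.
    by rewrite filter_uniq ?iota_uniq.
  move=> i; rewrite !mem_filter mem_iota => /andP [h hi]; rewrite hi andbT.
  have := h; move=> /order_isoP [es _]; move: h; congr order_iso.
  rewrite drop_cat; move: hi; rewrite /= add0n => hi; rewrite hi.
  by rewrite takel_cat // es size_take_min geq_minr.
apply: eq_leq; apply: eq_count => i /=.
by rewrite drop_cat ifN ?addKn // -leqNgt leq_addr.
Qed.

Lemma max_nu_ge p k n w : size w = n -> all (fun c => 0 < c <= k) w ->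
  nu p w <= max_nu p k n.
Proof.
move=> sw /allP hw.
case: k hw => [|k] hw.
  by case: w sw hw => [|c w] _ hw //; have := hw c; rewrite inE eqxx => /(_ isT); lia.
have st : size [seq (inord c.-1 : 'I_k.+1) | c <- w] == n by rewrite size_map sw.
have -> : w = letters (Tuple st).
  rewrite /letters /= -map_comp -[LHS]map_id; apply/eq_in_map => c /hw hc /=.
  by rewrite inordK; lia.
exact: (bigop.leq_bigmax (F := fun t : n.-tuple 'I_k.+1 => nu p (letters t))).
Qed.

Lemma size_letters k n (w : n.-tuple 'I_k) : size (letters w) = n.
Proof. by rewrite size_map size_tuple. Qed.

Lemma lettersP k n (w : n.-tuple 'I_k) : all (fun c => 0 < c <= k) (letters w).
Proof. by apply/allP => c /mapP [i _ ->]; rewrite ltn_ord. Qed.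

Lemma max_nu_le p k n b : (forall w, size w = n ->
   all (fun c => 0 < c <= k) w -> nu p w <= b) -> max_nu p k n <= b.
Proof. by move=> h; apply/bigmax_leqP => w _; apply: h (size_letters w) (lettersP w). Qed.

Lemma max_nu_homo p n k k' : k <= k' -> max_nu p k n <= max_nu p k' n.
Proof.
move=> hk; apply: max_nu_le => w sw hw; apply: max_nu_ge => //.
by apply: sub_all hw => c; lia.
Qed.

Lemma max_nu_leq p k n : max_nu p k n <= n.
Proof.
by apply: max_nu_le => w <- _; rewrite -[X in _ <= X](size_iota 0); apply: count_size.
Qed.

Lemma max_nu_superadd p k n1 n2 : 0 < k ->
  max_nu p k n1 + max_nu p k n2 <= max_nu p k (n1 + n2).
Proof.
move=> k0.
have ex n : exists2 w, size w = n /\ all (fun c => 0 < c <= k) w &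
    max_nu p k n = nu p w.
  have c0 : 0 < #|{: n.-tuple 'I_k}| by rewrite card_tuple card_ord expn_gt0 k0.
  have [w e] : {w : n.-tuple 'I_k | max_nu p k n = nu p (letters w)}.
    exact: (@bigop.eq_bigmax {: n.-tuple 'I_k} (fun w => nu p (letters w)) c0).
  by exists (letters w) => //; rewrite size_letters lettersP.
have [u [su hu] ->] := ex n1; have [v [sv hv] ->] := ex n2.
apply: leq_trans (nu_cat p u v) _; apply: max_nu_ge.
  by rewrite size_cat su sv.
by rewrite all_cat hu.
Qed.

Lemma max_nu_upper a k n : all (fun x => 0 < x) a -> 1 < size a ->
  max_nu (layered a) k n * M_pi a <= n + M_pi a.
Proof.
move=> a0 l1; have [M0 _ _] := M_piP a0 l1.
rewrite -leq_divRL //; apply: max_nu_le => w <- _.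
by rewrite leq_divRL // nu_upper.
Qed.

Lemma max_nu_lower a k n : all (fun x => 0 < x) a -> 1 < size a ->
  n * n + n <= k -> n <= max_nu (layered a) k n * M_pi a + (sumn a + M_pi a).
Proof.
move=> a0 l1 hk; have [M0 ov _] := M_piP a0 l1.
have m0 : 0 < sumn a by case: (a) a0 l1 => //= x s; lia.
apply: leq_trans (cut_word_lower M0 ov n m0) _; rewrite leq_add2r leq_mul2r.
apply/orP; right; apply: max_nu_ge; first by rewrite size_mkseq.
by apply: sub_all (cut_word_letters _ n) => c; lia.
Qed.

Local Open Scope ring_scope.
Local Open Scope classical_set_scope.

(** * Limits *)

Lemma cvg_affine_ratio (R : realType) (m : nat) (x y : R) :
  (fun n => (x * n%:R + y) / (n - m + 1)%:R) @ \oo --> x.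
Proof.
rewrite -(cvg_shiftn m) /=.
have h : (fun n => x + (x * (m%:R - 1) + y) * @harmonic R n) @ \oo --> x.
  rewrite -[X in _ --> X]addr0; apply: cvgD; first exact: cvg_cst.
  rewrite -[X in _ --> X](mulr0 (x * (m%:R - 1) + y)).
  by apply: cvgM; [exact: cvg_cst|exact: cvg_harmonic].
apply: cvg_trans h; apply: near_eq_cvg; near=> n.
rewrite addnK natrD /harmonic /= addn1.
have h0 : n%:R + 1 != 0 :> R by rewrite natr1 pnatr_eq0.
by rewrite -natr1; field.
Unshelve. all: by end_near. Qed.

Lemma superadd_mul (g : nat -> nat) :
  (forall n1 n2, g n1 + g n2 <= g (n1 + n2))%N ->
  forall q k r, (q * g k <= g (q * k + r))%N.
Proof.
move=> sg q k; elim: q => [//|q IH] r.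
have := sg k (q * k + r)%N; have := IH r.
by rewrite mulSn mulSn addnA; lia.
Qed.

(** Fekete's lemma for a superadditive [g] with [g n <= n]. The limit is the
    supremum of the [g n / n], hence the second conclusion: each single value
    bounds the limit from below, which later makes the estimate for [max_nu]
    uniform in the alphabet. *)
Lemma fekete (R : realType) (m : nat) (g : nat -> nat) :
  (forall n1 n2, g n1 + g n2 <= g (n1 + n2))%N -> (forall n, g n <= n)%N ->
  exists L : R, (fun n => (g n)%:R / (n - m + 1)%:R) @ \oo --> L /\
    forall n, (g n)%:R <= L * n%:R.
Proof.
move=> sg gn; pose A : set R := range (fun n => (g n.+1)%:R / n.+1%:R).
have ubA : has_ubound A.
  by exists 1 => _ [n _ <-]; rewrite ler_pdivrMr // mul1r ler_nat.
have A0 : A !=set0 by exists ((g 1%N)%:R / 1%:R), 0%N.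
pose L := sup A; exists L.
have gL n : (g n)%:R <= L * n%:R.
  case: n => [|n]; first by have := gn 0%N; rewrite leqn0 => /eqP ->; rewrite mulr0.
  by rewrite -ler_pdivrMr //; apply: ub_le_sup => //; exists n.
split=> //; apply/cvgrPdist_le => e e0.
have [_ [k _ <-] hk] := sup_adherent (divr_gt0 e0 (ltr0Sn R 1)) (conj A0 ubA).
pose x : R := (g k.+1)%:R / k.+1%:R.
have low n : x * n%:R - (g k.+1)%:R <= (g n)%:R.
  have h : (n * g k.+1 <= g n * k.+1 + k.+1 * g k.+1)%N.
    have := superadd_mul sg (n %/ k.+1) k.+1 (n %% k.+1).
    rewrite -divn_eq => h1; have := ltn_ceil n (ltn0Sn k) => h2.
    have h3 : (n * g k.+1 <= (n %/ k.+1).+1 * k.+1 * g k.+1)%N.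
      by rewrite leq_mul2r ltnW ?orbT.
    have h4 : (n %/ k.+1 * g k.+1 * k.+1 <= g n * k.+1)%N by rewrite leq_mul2r h1 orbT.
    by apply: leq_trans h3 _; rewrite mulSn mulnDl; lia.
  move: h; rewrite -(ler_nat R) natrD !natrM => h.
  rewrite lerBlDr /x -(ler_pM2r (ltr0Sn R k)) mulrAC divfK ?pnatr_eq0 //.
  by rewrite mulrDl mulrC (mulrC (g k.+1)%:R k.+1%:R).
(* The error [e] is split: one half for the choice of [k], one half for the
   convergence of the affine lower bound to [x]. *)
have x_lt : L - e < x by rewrite -/x -/L in hk; lra.
have L_lt : L < L + e by rewrite ltrDl.
have nlow : \forall n \near \oo,
    L - e <= (x * n%:R - (g k.+1)%:R) / (n - m + 1)%:R.
  exact: cvgr_ge (@cvg_affine_ratio R m x _) _ x_lt.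
have nup : \forall n \near \oo, (L * n%:R + 0) / (n - m + 1)%:R <= L + e.
  exact: cvgr_le (@cvg_affine_ratio R m L _) _ L_lt.
near=> n.
have d0 : 0 < (n - m + 1)%:R^-1 :> R by rewrite invr_gt0 ltr0n addn1.
rewrite ler_distlC; apply/andP; split.
  have h : L - e <= (x * n%:R - (g k.+1)%:R) / (n - m + 1)%:R by near: n.
  by rewrite (le_trans h) // ler_pM2r.
have h : (L * n%:R + 0) / (n - m + 1)%:R <= L + e by near: n.
by rewrite (le_trans _ h) // ler_pM2r // addr0.
Unshelve. all: by end_near. Qed.

Theorem theorem3p4 (R : realType) (a : seq nat)
    (a_gt0 : all (fun x => 0 < x)%N a) (l_gt1 : (1 < size a)%N) :
  [/\ (* the limits defining delta exist, and delta = 1 / M_pi *)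
      forall n, (size (layered a) <= n)%N ->
        cvgn (fun k => density R (layered a) k n),
      cvgn (fun n => limn (fun k => density R (layered a) k n))
    & delta R (layered a) = 1 / (M_pi a)%:R] /\
  [/\ (* the limits defining delta' exist, and delta' = 1 / M_pi *)
      forall k, (0 < k)%N -> cvgn (fun n => density R (layered a) k n),
      cvgn (fun k => limn (fun n => density R (layered a) k n))
    & delta' R (layered a) = 1 / (M_pi a)%:R].
Proof.
have [M_gt0 _ _] := M_piP a_gt0 l_gt1.
set p := layered a; set m := size p; set M := M_pi a in M_gt0 *.
pose c : R := (sumn a + M)%:R / M%:R.
have M0 : 0 < M%:R :> R by rewrite ltr0n.
have up k n : (max_nu p k n)%:R <= 1 / M%:R * n%:R + 1 :> R.
  rewrite -(ler_pM2r M0) mulrDl mulrAC divfK ?gt_eqF // !mul1r.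
  by rewrite -natrM -natrD ler_nat max_nu_upper.
have low k n : (n * n + n <= k)%N -> 1 / M%:R * n%:R - c <= (max_nu p k n)%:R.
  move=> hk; rewrite lerBlDr -(ler_pM2r M0) mulrAC divfK ?gt_eqF // mul1r.
  rewrite mulrDl /c divfK ?gt_eqF //.
  by rewrite -natrM -natrD ler_nat max_nu_lower.
have d0 n : 0 < (n - m + 1)%:R^-1 :> R by rewrite invr_gt0 ltr0n addn1.
have upd k n : density R p k n <= (1 / M%:R * n%:R + 1) / (n - m + 1)%:R.
  by rewrite ler_pM2r.
have lowd k n : (n * n + n <= k)%N ->
    (1 / M%:R * n%:R - c) / (n - m + 1)%:R <= density R p k n.
  by move=> hk; rewrite ler_pM2r // low.
have cvg_k n : cvgn (fun k => density R p k n).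
  apply: nondecreasing_is_cvgn.
    by move=> k k' hk; rewrite ler_pM2r // ler_nat max_nu_homo.
  by exists ((1 / M%:R * n%:R + 1) / (n - m + 1)%:R) => _ [k _ <-].
have cvg1 : (fun n => limn (fun k => density R p k n)) @ \oo --> (1 / M%:R : R).
  apply: (@squeeze_cvgr _ _ _ _
    (fun n => (1 / M%:R * n%:R - c) / (n - m + 1)%:R)
    (fun n => (1 / M%:R * n%:R + 1) / (n - m + 1)%:R));
    [|exact: cvg_affine_ratio|exact: cvg_affine_ratio].
  near=> n; apply/andP; split.
    apply: limr_ge; first exact: cvg_k.
    by exists (n * n + n)%N => // k /= hk; apply: lowd.
  apply: limr_le; first exact: cvg_k.
  by near=> k; apply: upd.
have fek k : (0 < k)%N -> exists L : R,
    density R p k @ \oo --> L /\ forall n, (max_nu p k n)%:R <= L * n%:R.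
  move=> k0; apply: fekete => [n1 n2|n]; last exact: max_nu_leq.
  exact: max_nu_superadd.
have cvg_n k : (0 < k)%N -> cvgn (fun n => density R p k n).
  by move=> /fek [L [hL _]]; apply: cvgP hL.
have cvg2 : (fun k => limn (fun n => density R p k n)) @ \oo --> (1 / M%:R : R).
  apply/cvgrPdist_le => e e0.
  (* A single length [n] with [c / n <= e] serves every alphabet large enough
     for the word constructed at that length. *)
  have [n hn] : exists n, c / n.+1%:R <= e.
    exists (Num.truncn (c / e)); rewrite ler_pdivrMr // mulrC -ler_pdivrMr //.
    by rewrite ltW // truncnS_gt.
  exists (n.+1 * n.+1 + n.+1)%N => // k /= hk.
  have k0 : (0 < k)%N by lia.
  have [L [hL Lmax]] := fek k k0.
  have -> : limn (fun n => density R p k n) = L by apply: cvg_lim hL.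
  have L_le : L <= 1 / M%:R.
    apply: (ler_cvg_to hL (@cvg_affine_ratio R m (1 / M%:R) 1)).
    by near=> n'; apply: upd.
  rewrite ger0_norm ?subr_ge0 // lerBlDr -lerBlDl.
  have h := le_trans (low k n.+1 hk) (Lmax n.+1).
  rewrite -(ler_pM2r (ltr0Sn R n)); apply: le_trans h.
  by rewrite mulrBl lerD2l lerN2 -ler_pdivrMr.
split; split.
- by move=> n _; apply: cvg_k.
- exact: cvgP cvg1.
- exact: cvg_lim cvg1.
- exact: cvg_n.
- exact: cvgP cvg2.
- exact: cvg_lim cvg2.
Unshelve. all: by end_near. Qed.
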